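(* Let $C = (m\mathbb{N} + A) \cup B \cup F$ be an eventually periodic set of period $m$. Suppose $m$ is a prime with $m\equiv 2 \pmod 3$, $|F| = 1$, and $|A| = (m+1)/3$. Suppose further that there exist $Y_+, Y_-, Y_0\subseteq \mathbb{Z}/m\mathbb{Z}$ such that, with $\overline{Y} = Y_+ \cup Y_- \cup Y_0$, the following conditions (1)-(3) hold, and that (4) holds: (1) $\left(A_{(m)} + \overline{Y}\right) \cup \left(F_{(m)} + Y_+\right) = (A_{(m)} \cup F_{(m)}) + Y_- = \mathbb{Z}/m\mathbb{Z}$; (2) for each $a \in A_{(m)}$, there exists $y_a \in Y_0$ such that $$a + y_a \in (F_{(m)} + Y_-) \setminus \Big(\big((A_{(m)}\setminus \{a\}) + Y_0\big) \cup \big(A_{(m)} + (Y_- \cup Y_+)\big)\Big);$$ (3) for each $f \in F_{(m)}$, there exists $y \in \overline{Y}$ such that $f + y \notin A_{(m)} + Y_-$; (4) for each $a \in A_{(m)}$, there is some $W\subseteq\mathbb{Z}$ such that $(m\mathbb{Z} + a) \cap (\mathbb{Z} \setminus C) = (m \mathbb{Z} + a) \cap (F + W)$. Then $C$ arises as a minimal additive complement in $\mathbb{Z}$.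
   Context: $\mathbb{N}=\{1,2,3,\dots\}$. For $S\subseteq\mathbb{Z}$, $S_{(m)}$ denotes the image of $S$ in $\mathbb{Z}/m\mathbb{Z}$ under the standard projection; for $a\in\mathbb{Z}/m\mathbb{Z}$, $m\mathbb{Z}+a$ denotes the corresponding residue class, viewed as a subset of $\mathbb{Z}$. Sums of sets are Minkowski sums. $C\subseteq\mathbb{Z}$ arises as a minimal additive complement if there is $W\subseteq\mathbb{Z}$ with $C+W=\mathbb{Z}$ and $C'+W\neq\mathbb{Z}$ for every proper subset $C'\subsetneq C$. An eventually periodic set of period $m$ is a set of integers of the form $(m\mathbb{N}+A)\cup B\cup F$, where $A$ is nonempty, $B$ and $F$ are finite, $B_{(m)}\subseteq A_{(m)}$ and $F_{(m)}\cap A_{(m)}=\emptyset$. It is assumed throughout that the representation is normalized so that $(m,A,B,F)$ is unique: $m$ is the minimal period, $A$ has at most one element in each residue class modulo $m$, and $b\notin A+m\mathbb{Z}_{\ge 0}$ for every $b\in B$. *)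

(* Defs.v *)
From mathcomp Require Import all_boot all_order all_algebra.
From mathcomp Require Import boolp classical_sets functions cardinality.

Set Implicit Arguments.
Unset Strict Implicit.
Unset Printing Implicit Defensive.

Import GRing.Theory.
Local Open Scope classical_set_scope.
Local Open Scope ring_scope.

Definition minkowski_sum (G : zmodType) (A B : set G) : set G :=
  [set a + b | a in A & b in B].

Notation "A :+: B" := (minkowski_sum A B)
  (at level 50, left associativity) : classical_set_scope.

Definition is_min_complement (C W : set int) : Prop :=
  C :+: W = setT /\ (forall C' : set int, C' `<` C -> C' :+: W <> setT).

Definition arises_as_min_complement (C : set int) : Prop :=
  exists W : set int, is_min_complement C W.

(* m N, where N starts at 1. *)
Definition pos_multiples (m : nat) : set int :=
  [set m%:Z * n%:Z | n in [set n : nat | (0 < n)%N]].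

(* m Z_{>= 0} *)
Definition nonneg_multiples (m : nat) : set int :=
  [set m%:Z * n%:Z | n in [set: nat]].

(* Residue conditions are written as congruences here rather than in 'Z_m:
   the period ranges over all m > 0, and 'Z_1 is a copy of Z/2Z. *)
Record eventually_periodic_form (m : nat) (A B F C : set int) : Prop := {
  epf_period_gt0 : (0 < m)%N ;
  epf_eq : C = (pos_multiples m :+: A) `|` B `|` F ;
  epf_A_neq0 : A !=set0 ;
  epf_B_finite : finite_set B ;
  epf_F_finite : finite_set F ;
  epf_B_sub_A : forall b, B b -> exists2 a, A a & (b = a %[mod m%:Z])%Z ;
  epf_F_disj_A : forall f a, F f -> A a -> (f <> a %[mod m%:Z])%Z
}.

Record normalized_eventually_periodic_form
    (m : nat) (A B F C : set int) : Prop := {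
  nepf_form : eventually_periodic_form m A B F C ;
  nepf_min_period : forall (m' : nat) (A' B' F' : set int),
    eventually_periodic_form m' A' B' F' C -> (m <= m')%N ;
  nepf_A_uniq : forall x y : int,
    A x -> A y -> (x = y %[mod m%:Z])%Z -> x = y ;
  nepf_B_notin : forall b : int, B b -> ~ (A :+: nonneg_multiples m) b
}.

(* The projections below are to be used with 1 < m only, since 'Z_0 and 'Z_1
   are copies of Z/2Z. *)
Definition residues (m : nat) (S : set int) : set 'Z_m :=
  [set (x%:~R : 'Z_m) | x in S].

Arguments residues m S : clear implicits.

Definition residue_class (m : nat) (a : 'Z_m) : set int :=
  [set x : int | x%:~R = a].

Lemma eq_residue (m : nat) (x y : int) :
  (1 < m)%N -> (x%:~R == y%:~R :> 'Z_m) = (x == y %[mod m%:Z])%Z.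
Proof.
move=> m1; rewrite eqz_mod_dvd -subr_eq0 -rmorphB /=.
have E (n : nat) : (n%:R == 0 :> 'Z_m) = (m %| n)%N.
  by rewrite -(inj_eq val_inj) /= val_Zp_nat.
case: (x - y) => n; first by rewrite -pmulrn E.
by rewrite NegzE rmorphN /= oppr_eq0 -pmulrn E dvdzE abszN !absz_nat.
Qed.

(* Main.v *)
(* Write C = (m N + A) `|` B `|` {f}, and pick for each residue a of A a class
   y_a in Y0 as in (2).  The complement W consists of the representative
   w_a in [0, m) of every y_a and, in each class z of Y-, of all the integers w
   except those for which f + w is already reached by C + w_a in a class
   a + y_a.  In the class a + y_a the sets C + w_a and f + W are then
   complementary and nothing else contributes, which makes every element of C
   in the class a essential; f is essential because, in the class given by (3),
   C \ {f} + W is bounded below. *)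
Require Import Defs.
From mathcomp Require Import all_boot all_order all_algebra.
From mathcomp Require Import boolp classical_sets functions cardinality.
From mathcomp Require Import zify.

Import Order.TTheory GRing.Theory Num.Theory.

Local Open Scope classical_set_scope.
Local Open Scope ring_scope.

Lemma finite_set_int_lbound {S : set int} :
  finite_set S -> exists l : int, forall x, S x -> l <= x.
Proof.
move=> /finite_seqP[s ->]; elim: s => [|y s [l hl]]; first by exists 0.
exists (Order.min y l) => x /=; rewrite inE => /orP[/eqP->|xs].
  by rewrite ge_min lexx.
by rewrite ge_min (hl x xs) orbT.
Qed.

Lemma residue_addMl {m : nat} (k x : int) : (1 < m)%N ->
  (m%:Z * k + x)%:~R = x%:~R :> 'Z_m.
Proof. by move=> m1; apply/eqP; rewrite eq_residue // mulrC modzMDl. Qed.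

Lemma residue_far_below {m : nat} (y : 'Z_m) (l : int) : (1 < m)%N ->
  exists2 w : int, w%:~R = y & w < l.
Proof.
(* Since m >= 1, the value is at most -(|l| + y + 1) + y < l. *)
move=> m1; exists (m%:Z * - (`|l|%N + y + 1)%:Z + (y : nat)%:Z).
  by rewrite residue_addMl // -pmulrn natr_Zp.
by nia.
Qed.

Section EventuallyPeriodic.

Context {m : nat} {A B F C : set int}.
Hypotheses (m1 : (1 < m)%N) (hC : eventually_periodic_form m A B F C).

Lemma eventually_periodic_lbound :
  finite_set A -> exists l : int, forall x, C x -> l <= x.
Proof.
case: hC => _ -> _ Bfin Ffin _ _ Afin.
have [lA hA] := finite_set_int_lbound Afin.
have [lB hB] := finite_set_int_lbound Bfin.
have [lF hF] := finite_set_int_lbound Ffin.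
exists (Order.min lA (Order.min lB lF)) => x.
case=> [[[_ [n _ <-] [a Aa <-]] | /hB] | /hF]; rewrite !ge_min.
- by rewrite ler_wpDl ?hA ?mulr_ge0.
- by move=> ->; rewrite orbT.
- by move=> ->; rewrite !orbT.
Qed.

Lemma eventually_periodic_residue (x : int) :
  C x -> residues m A x%:~R \/ F x.
Proof.
case: hC => _ -> _ _ _ hB _.
case=> [[[_ [n _ <-] [a Aa <-]] | Bx] | Fx]; last by right.
  by left; exists a => //; rewrite residue_addMl.
left; have [a Aa bE] := hB x Bx.
by exists a => //; apply/eqP; rewrite eq_residue // bE.
Qed.

Lemma eventually_periodic_far_above {a : 'Z_m} : residues m A a ->
  exists u : int, forall x : int, x%:~R = a -> u < x -> C x.
Proof.
case: hC => _ -> _ _ _ _ _ [a0 Aa0 <-]; exists a0 => x /eqP.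
rewrite eq_residue // eqz_mod_dvd => /dvdzP[k kE] a0x.
(* As [a0 < x], the quotient [k] is positive, so [x] already lies in m N + a0. *)
left; left; exists (m%:Z * `|k|%N%:Z).
  by exists `|k|%N => //=; nia.
by exists a0 => //; nia.
Qed.

End EventuallyPeriodic.

(** Conditions (1)-(3) specialised to F = {f}: [y] picks the y_a of (2), and [f] is moved to the
    other side, so that a + y_a - f is a class of [Ym] to be thinned out in the complement. *)
Lemma min_complement_singleton (m : nat) (A B C : set int) (f : int)
    (Ym Y0 : set 'Z_m) (y : 'Z_m -> 'Z_m) :
  (1 < m)%N -> finite_set A ->
  eventually_periodic_form m A B [set f] C ->
  (residues m A `|` [set f%:~R]) :+: Ym = setT ->
  (forall a, residues m A a -> Y0 (y a)) ->
  (forall a, residues m A a -> Ym (a + y a - f%:~R)) ->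
  (forall a, residues m A a ->
     ~ ((residues m A `\` [set a]) :+: Y0) (a + y a)) ->
  (forall a, residues m A a -> ~ (residues m A :+: Ym) (a + y a)) ->
  (exists t : 'Z_m, ~ (residues m A :+: Ym) t) ->
  arises_as_min_complement C.
Proof.
move=> m1 Afin hC cover yY0 yF yA yAm [t0 t0P].
have [l Cl] := eventually_periodic_lbound hC Afin.
have Cres := eventually_periodic_residue m1 hC.
have Cf : C f by case: hC => _ -> *; right.
pose rep a : int := (y a : nat)%:Z.
have repK a : (rep a)%:~R = y a by rewrite -pmulrn natr_Zp.
pose W : set int := [set w | (exists2 a, residues m A a & w = rep a) \/
  Ym w%:~R /\ forall a, residues m A a -> w%:~R + f%:~R = a + y a ->
    ~ C (w + f - rep a)].
exists W; split.
  rewrite -subTset => n _.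
  have : ((residues m A `|` [set f%:~R]) :+: Ym) n%:~R by rewrite cover.
  have [[a Aa [z Yz nE]] _|nA] := pselect ((residues m A :+: Ym) n%:~R).
    (* A low enough [w] in the class [z] serves twice: w + f - rep b < l escapes the exclusion in
       [W], because rep b >= 0, and n - w > u puts n - w in [C]. *)
    have [u Cu] := eventually_periodic_far_above m1 hC Aa.
    have [w wz wl] := residue_far_below z (Order.min (l - f) (n - u)) m1.
    move: wl; rewrite lt_min => /andP[wl wu].
    exists (n - w); last first.
      exists w; last by rewrite subrK.
      right; split; first by rewrite wz.
      by move=> b _ _ /Cl; rewrite /rep; lia.
    by apply: Cu; [rewrite rmorphB /= wz -nE addrK | lia].
  case=> b [Ab|->] [z Yz nE]; first by case: nA; exists b => //; exists z.
  (* Now n - f lies in a class of [Ym]: either some C + rep a contains [n], or n - f survives the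
     exclusion in [W]. *)
  have [[a [Aa naE Ca]]|nC] := pselect (exists a,
      [/\ residues m A a, n%:~R = a + y a & C (n - rep a)]).
    exists (n - rep a) => //; exists (rep a); last by rewrite subrK.
    by left; exists a.
  exists f => //; exists (n - f); last by rewrite addrC subrK.
  right; split; first by rewrite rmorphB /= -nE addrC addKr.
  move=> a Aa; rewrite -rmorphD /= subrK => naE Ca.
  by apply: nC; exists a.
move=> C' [C'C /nonsubset[c [Cc nC'c]]] C'W.
have [cA|] := Cres c Cc.
  (* The integer c + rep c can only be reached from [c]. *)
  have : (C' :+: W) (c + rep c%:~R) by rewrite C'W.
  case=> c' C'c' [w Ww E].
  have Er : c'%:~R + w%:~R = c%:~R + y c%:~R :> 'Z_m.
    by rewrite -repK -!rmorphD /= E.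
  case: (Cres c' (C'C _ C'c')) => [c'A|c'E].
    (* [yAm] rules out a class of [Ym] for [w], and [yA] a class other than that of [c] for [c'];
       then y b = y c, so w = rep c and c' = c. *)
    case: Ww => [[b Ab wE]|[Yw _]]; last first.
      by apply: (yAm _ cA); rewrite -Er; exists c'%:~R => //; exists w%:~R.
    have yb : c'%:~R + y b = c%:~R + y c%:~R by rewrite -Er wE repK.
    have [ceq|cneq] := pselect (c'%:~R = c%:~R :> 'Z_m); last first.
      apply: (yA _ cA); rewrite -yb; exists c'%:~R => //.
      by exists (y b) => //; exact: yY0.
    move: yb; rewrite ceq => /addrI yb; apply: nC'c.
    by move: E; rewrite wE /rep yb => /addIr <-.
  rewrite /= in c'E; subst c'.
  case: Ww => [[b Ab wE]|[_ wP]].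
    (* Here y b = c + y c - f is itself a class of [Ym], so b + y b would lie in A + Ym. *)
    apply: (yAm _ Ab); exists b => //; exists (y b) => //.
    have := yF _ cA; rewrite -Er addrC addKr.
    by rewrite wE repK.
  (* The integer w + f - rep c equals [c], which is in [C], so [w] was excluded from [W]. *)
  apply: (wP _ cA); first by rewrite addrC Er.
  by rewrite [w + f]addrC E addrK.
move=> cf; rewrite /= in cf; subst c.
(* Without [f], the integer [n] is out of reach: every C + rep b stays at or above [l], and A + Ym
   misses the class [t0]. *)
have [n nt nl] := residue_far_below t0 l m1.
have : (C' :+: W) n by rewrite C'W.
case=> c' C'c' [w Ww E].
case: (Cres c' (C'C _ C'c')) => [c'A|c'E]; last by rewrite /= in c'E; subst c'.
case: Ww => [[b Ab wE]|[Yw _]].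
  by have := Cl c' (C'C _ C'c'); move: E; rewrite wE /rep; lia.
apply: t0P; rewrite -nt -E rmorphD /=.
by exists c'%:~R => //; exists w%:~R.
Qed.

Theorem theorem7 (m : nat) (A B F C : set int)
  (hC : normalized_eventually_periodic_form m A B F C)
  (hm : prime m)
  (hm3 : (m = 2 %[mod 3])%N)
  (hF : (F #= `I_1)%card)
  (hA : (A #= `I_((m + 1) %/ 3)%N)%card)
  (hY : exists Yp Ym Y0 : set 'Z_m,
    let Y := Yp `|` Ym `|` Y0 in
    let Am := residues m A in
    let Fm := residues m F in
    [/\ (Am :+: Y) `|` (Fm :+: Yp) = setT /\ (Am `|` Fm) :+: Ym = setT,
        forall a, Am a -> exists2 y, Y0 y &
          ((Fm :+: Ym) `\`
            (((Am `\` [set a]) :+: Y0) `|` (Am :+: (Ym `|` Yp)))) (a + y)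
      & forall f, Fm f -> exists2 y, Y y & ~ (Am :+: Ym) (f + y)])
  (h4 : forall a : 'Z_m, residues m A a -> exists W : set int,
    residue_class a `&` ~` C = residue_class a `&` (F :+: W)) :
  arises_as_min_complement C.
Proof.
have m1 := prime_gt1 hm.
have [f FE] : exists f, F = [set f].
  have [g [gF ginj gsurj]] := card_set_bijP hF.
  have [f Ff _] := gsurj 0%N isT; exists f; apply/seteqP; split => [x Fx|_ -> //].
  apply: ginj; rewrite ?inE //.
  by move: (gF x Fx) (gF f Ff) => /=; lia.
move: hC hY; rewrite {}FE => -[hform _ _ _].
have -> : residues m [set f] = [set f%:~R].
  by rewrite /residues image_set1.
case=> Yp [Ym [Y0 [[_ cover] h2 h3]]].
have /choice[y yP] : forall a, exists y, residues m A a -> Y0 y /\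
    (([set f%:~R] :+: Ym) `\` (((residues m A `\` [set a]) :+: Y0)
       `|` (residues m A :+: (Ym `|` Yp)))) (a + y).
  (* Outside the residues of [A] the value 0 is a dummy. *)
  move=> a; have [/h2[y]|nAa] := pselect (residues m A a); last by exists 0.
  by exists y.
have Afin : finite_set A by exists ((m + 1) %/ 3)%N.
apply: (@min_complement_singleton m A B C f Ym Y0 y) => //.
- by move=> a /yP[].
- move=> a /yP[_ [[_ -> [z Yz <-]] _]].
  by rewrite addrC addKr.
- by move=> a /yP[_ [_ nA]] aA; apply: nA; left.
- move=> a /yP[_ [_ nA]] [b Ab [z Yz zE]]; apply: nA; right.
  by exists b => //; exists z => //; left.
- by have [z _ zP] := h3 _ (erefl _); exists (f%:~R + z).
Qed.
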